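(* Let $\mathcal H$ be a $\mathbb Z$-graded $\mathbb C$-vector space with an odd constant symplectic structure $\omega$, let $\{\phi^i\}$ be the dual coordinates (fields) of a basis $\{e_i\}$, and let $$S=\tfrac12\mathcal V_{i_1i_2}\phi^{i_2}\phi^{i_1}+\sum_{k\ge3}\tfrac1k\mathcal V_{i_1\cdots i_k}\phi^{i_k}\cdots\phi^{i_1},\qquad \mathcal V_{i_1\cdots i_k}\in\mathbb C,$$ be the degree zero action of a field theory. If the action is cyclic, $S\in C(\phi)_c$, and satisfies the classical BV master equation $(S,S)=0$, then the field theory has a cyclic $A_\infty$-structure: the multilinear maps $m_k:\mathcal H^{\otimes k}\to\mathcal H$ $(k\ge1)$ determined by $$(-1)^{e_{i_1}}\omega(e_{i_1},m_k(e_{i_2},\dots,e_{i_{k+1}}))=\mathcal V_{i_1\cdots i_{k+1}}$$ make $(\mathcal H,\omega,\{m_k\}_{k\ge1})$ a cyclic $A_\infty$-algebra.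
   Context: In exponents of $(-1)$, $e_i$, $i$ and $o$ stand for degrees. An odd constant symplectic structure is a nondegenerate bilinear map $\omega:\mathcal H\otimes\mathcal H\to\mathbb C$ of degree $-1$ (nonzero on homogeneous $o,o'$ only if $\deg o+\deg o'=1$) with $\omega(o',o)=-\omega(o,o')$. Put $\omega_{ij}=\omega(e_i,e_j)$ and let $\omega^{ij}$ be the inverse matrix, $\omega_{ij}\omega^{jk}=\delta_i^k$. The coordinates $\phi^i$ are associative, noncommuting, of degree $-\deg e_i$. $C(\phi)_c$ is the space of formal power series $\sum_k\frac1k a_{i_1\cdots i_k}\phi^{i_k}\cdots\phi^{i_1}$ with cyclic coefficients $a_{i_1\cdots i_k}=(-1)^{(i_2+\cdots+i_k)i_1}a_{i_2\cdots i_ki_1}$. The odd Poisson (BV) bracket $(\ ,\ )=\frac{\overleftarrow\partial}{\partial\phi^i}\omega^{ij}\frac{\overrightarrow\partial}{\partial\phi^j}$ on $C(\phi)_c$ is given on $A=\frac1k a_{i_1\cdots i_k}\phi^{i_k}\cdots\phi^{i_1}$, $B=\frac1l b_{j_1\cdots j_l}\phi^{j_l}\cdots\phi^{j_1}$ by $$(A,B)=\tfrac1{k+l-2}\,a_{i_1\cdots i_k}\omega^{i_1j_l}b_{j_1\cdots j_l}\big(\phi^{i_k}\cdots\phi^{i_2}\phi^{j_{l-1}}\cdots\phi^{j_1}+\text{cyclic}\big),$$ where ''+ cyclic'' is the sum over all $k+l-2$ cyclic rotations of the word with Koszul signs. An $A_\infty$-algebra is a graded vector space with degree $+1$ maps $m_k:\mathcal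 H^{\otimes k}\to\mathcal H$ $(k\ge1)$ such that $\sum_{k+l=n+1}\sum_{j=0}^{k-1}(-1)^{o_1+\cdots+o_j}m_k(o_1,\dots,o_j,m_l(o_{j+1},\dots,o_{j+l}),o_{j+l+1},\dots,o_n)=0$ for all $n\ge1$. $(\mathcal H,\omega,\{m_k\})$ is a cyclic $A_\infty$-algebra if in addition $\omega(o_1,m_k(o_2,\dots,o_{k+1}))=(-1)^{o_2}\omega(o_2,m_k(o_3,\dots,o_{k+1},o_1))$ for all $k\ge1$.
   Formalization: If the basis is infinite, the formal theorem also assumes that each column of ω^{ij} has finitely many nonzero entries and that V_{i i_2…i_k} is nonzero for only finitely many i once i_2,…,i_k are fixed; otherwise the m_k need not exist. Both are automatic for finite bases. *)

(* Defs.v *)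
From HB Require Import structures.
From mathcomp Require Import all_boot all_order all_algebra.
From mathcomp Require Import boolp classical_sets cardinality fsbigop reals.
From mathcomp Require Import complex.

Set Implicit Arguments.
Unset Strict Implicit.
Unset Printing Implicit Defensive.
Import Order.TTheory GRing.Theory Num.Theory.
Local Open Scope classical_set_scope.
Local Open Scope ring_scope.

Definition sgn (K : fieldType) (n : int) : K := (-1) ^ n.

(** * Graded spaces, homogeneous bases, odd symplectic structures *)

(* [gr n] is the subspace of the elements of degree [n]; the space is the
   internal direct sum of these subspaces. *)
Definition is_grading (K : fieldType) (H : lmodType K) (gr : int -> {pred H})
    : Prop :=
  [/\ forall n, submod_closed (gr n),
      forall x : H, exists (s : seq int) (c : int -> H),
        (forall n, c n \in gr n) /\ x = \sum_(n <- s) c n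
    & forall (s : seq int) (c : int -> H), uniq s ->
        (forall n, c n \in gr n) -> \sum_(n <- s) c n = 0 ->
        forall n, n \in s -> c n = 0].

Definition is_homogeneous_basis (K : fieldType) (H : lmodType K)
    (gr : int -> {pred H}) (I : choiceType) (e : I -> H) (d : I -> int)
    : Prop :=
  [/\ forall i, e i \in gr (d i),
      forall x : H, exists (s : seq I) (c : I -> K),
        x = \sum_(i <- s) c i *: e i
    & forall (s : seq I) (c : I -> K), uniq s ->
        \sum_(i <- s) c i *: e i = 0 -> forall i, i \in s -> c i = 0].

Definition is_odd_symplectic (K : fieldType) (H : lmodType K)
    (gr : int -> {pred H}) (omega : H -> H -> K) : Prop :=
  [/\ (forall x, scalar (omega x)) /\ (forall y, scalar (omega ^~ y)),
      forall x y, omega y x = - omega x y,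
      forall p q x y, x \in gr p -> y \in gr q ->
        omega x y != 0 -> p + q = 1
    & forall x, (forall y, omega x y = 0) -> x = 0].

(* [omega_inv j k] is the entry with upper indices j, k. The index set may be
   infinite: the columns of the inverse are then required to be finitely
   supported, so that the contractions below are finite sums. This is
   automatic when [I] is finite. *)
Definition is_inverse_matrix (K : fieldType) (H : lmodType K) (I : choiceType)
    (e : I -> H) (omega : H -> H -> K) (omega_inv : I -> I -> K) : Prop :=
  (forall k, finite_set [set j | omega_inv j k != 0]) /\
  (forall i k,
     \sum_(j \in [set: I]) omega (e i) (e j) * omega_inv j k = (i == k)%:R).

(** * Formal power series in the noncommuting coordinates *)

(* [A [:: i_1; ...; i_k]] is the coefficient of the word
   phi^{i_k} ... phi^{i_1} (in this order). *)
Definition series (K : fieldType) (I : choiceType) : Type := seq I -> K.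

(* The coordinate phi^i has degree - d i. *)
Definition has_degree (K : fieldType) (I : choiceType) (d : I -> int) (n : int)
    (A : series K I) : Prop :=
  forall w, A w != 0 -> \sum_(i <- w) - d i = n.

(* The coefficients a such that A is the sum of the
   1/k a_{i_1 ... i_k} phi^{i_k} ... phi^{i_1}. *)
Definition coef (K : fieldType) (I : choiceType) (A : series K I) :
    seq I -> K :=
  fun w => (size w)%:R * A w.

Definition cyclic_coef (K : fieldType) (I : choiceType) (d : I -> int)
    (a : seq I -> K) : Prop :=
  forall i w, a (i :: w) = sgn K ((\sum_(j <- w) d j) * d i) * a (rcons w i).

(* The space C(phi)_c; its elements have no constant term. *)
Definition Cphi_c (K : fieldType) (I : choiceType) (d : I -> int)
    (A : series K I) : Prop :=
  A [::] = 0 /\ cyclic_coef d (coef A).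

(* Finite support in the first index, the others being fixed; automatic when
   [I] is finite. For a cyclic series it makes every contraction finite. *)
Definition locally_finite (K : fieldType) (I : choiceType) (A : series K I)
    : Prop :=
  forall w, finite_set [set i | A (i :: w) != 0].

(* Coefficient of phi^{i_k} ... phi^{i_2} phi^{j_{l-1}} ... phi^{j_1}, that is
   of the list [:: j_1; ...; j_{l-1}; i_2; ...; i_k], in
   a_{i_1 ... i_k} omega^{i_1 j_l} b_{j_1 ... j_l} phi^{i_k} ... phi^{j_1}. *)
Definition contraction (K : fieldType) (I : choiceType)
    (omega_inv : I -> I -> K) (l : nat) (a b : seq I -> K) : series K I :=
  fun w => \sum_(i \in [set: I]) \sum_(j \in [set: I])
    a (i :: drop l.-1 w) * omega_inv i j * b (rcons (take l.-1 w) j).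

(* Koszul sign of moving the r rightmost letters phi^{i_r} ... phi^{i_1} of the
   word of [w] to its left end; the resulting word is that of [rot r w]. *)
Definition rot_sign (K : fieldType) (I : choiceType) (d : I -> int) (r : nat)
    (w : seq I) : K :=
  sgn K ((\sum_(i <- take r w) d i) * (\sum_(i <- drop r w) d i)).

(* The linear extension of "word + cyclic": the word of [w] arises as the r-th
   rotation of the word of [rotr r w]. *)
Definition cyclic_sum (K : fieldType) (I : choiceType) (d : I -> int)
    (t : series K I) : series K I :=
  fun w => \sum_(r < size w) rot_sign K d r (rotr r w) * t (rotr r w).

(* The (A, B) formula summed over all k, l >= 1; only k + l - 2 = size w
   contributes to the coefficient of [w]. *)
Definition bracket (K : fieldType) (I : choiceType) (d : I -> int)
    (omega_inv : I -> I -> K) (A B : series K I) : series K I :=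
  fun w =>
    \sum_(1 <= k < (size w).+2)
      \sum_(1 <= l < (size w).+2 | (k + l - 2 == size w)%N)
        (k + l - 2)%:R^-1 *
        cyclic_sum d (contraction omega_inv l (coef A) (coef B)) w.

Definition action (K : fieldType) (I : choiceType) (V : seq I -> K) :
    series K I :=
  fun w => if (2 <= size w)%N then (size w)%:R^-1 * V w else 0.

(** * Cyclic A-infinity algebras *)

(* A family of maps m_k on k-tuples, k >= 1, is encoded as a single function
   [m] on lists: m_k is its restriction to the lists of size k. The value of
   [m] on the empty list is irrelevant. *)
Definition multilinear (K : fieldType) (H : lmodType K) (m : seq H -> H)
    : Prop :=
  forall s1 s2 : seq H, linear (fun x => m (s1 ++ x :: s2)).

(* A list of homogeneous vectors, each paired with its degree. *)
Definition homogeneous (K : fieldType) (H : lmodType K) (gr : int -> {pred H})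
    (s : seq (int * H)) : bool :=
  all (fun p => p.2 \in gr p.1) s.

Definition degs (K : fieldType) (H : lmodType K) (s : seq (int * H)) : int :=
  \sum_(p <- s) p.1.

Definition degree_one (K : fieldType) (H : lmodType K) (gr : int -> {pred H})
    (m : seq H -> H) : Prop :=
  forall s, s != [::] -> homogeneous gr s -> m (unzip2 s) \in gr (degs s + 1).

Definition Ainf_relations (K : fieldType) (H : lmodType K)
    (gr : int -> {pred H}) (m : seq H -> H) : Prop :=
  forall s, s != [::] -> homogeneous gr s ->
    let n := size s in
    let o := unzip2 s in
    \sum_(1 <= k < n.+1) \sum_(1 <= l < n.+1 | (k + l == n.+1)%N)
      \sum_(0 <= j < k)
        sgn K (degs (take j s)) *:
          m (take j o ++ m (take l (drop j o)) :: drop (j + l) o) = 0.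

Definition Ainf_algebra (K : fieldType) (H : lmodType K)
    (gr : int -> {pred H}) (m : seq H -> H) : Prop :=
  [/\ multilinear m, degree_one gr m & Ainf_relations gr m].

Definition cyclic_Ainf_algebra (K : fieldType) (H : lmodType K)
    (gr : int -> {pred H}) (omega : H -> H -> K) (m : seq H -> H) : Prop :=
  Ainf_algebra gr m /\
  (forall d1 d2 (o1 o2 : H) (s : seq (int * H)),
     o1 \in gr d1 -> o2 \in gr d2 -> homogeneous gr s ->
     omega o1 (m (o2 :: unzip2 s)) =
       sgn K d2 * omega o2 (m (rcons (unzip2 s) o1))).

(* The maps m_k, k >= 1, have the structure constants V_{i_1 ... i_{k+1}}. *)
Definition determined_by (K : fieldType) (H : lmodType K) (I : choiceType)
    (e : I -> H) (d : I -> int) (omega : H -> H -> K) (V : seq I -> K)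
    (m : seq H -> H) : Prop :=
  multilinear m /\
  (forall (i : I) (w : seq I), w != [::] ->
     sgn K (d i) * omega (e i) (m (map e w)) = V (i :: w)).

(* Main.v *)
Require Import Defs.
From HB Require Import structures.
From mathcomp Require Import all_boot all_order all_algebra.
From mathcomp Require Import boolp classical_sets cardinality fsbigop reals.
From mathcomp Require Import complex zify ring.

Set Implicit Arguments.
Unset Strict Implicit.
Unset Printing Implicit Defensive.
Import Order.TTheory GRing.Theory Num.Theory.
Local Open Scope classical_set_scope.
Local Open Scope ring_scope.

(** Paired with a basis vector, the A-infinity relations become half of the
    master equation.

    Let a be the coefficients of S and X the inverse of omega.  The vectors
    f_k = sum_j X_jk e_j satisfy omega(e_i, f_k) = delta_ik, so omega(_, f_k)
    is the k-th coordinate functional ([omega_dual_vec]).  Hence the vector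
    m(e_w) is forced to be the sum over c of (-1)^(d c) a_(c w) f_c
    ([structure_vec]), and m is its multilinear extension.  Nondegeneracy gives
    uniqueness, and S having degree zero gives the degree of m.  Cyclicity of m
    is cyclicity of a: since a lives on words of total degree zero, moving the
    letter i around the word costs just (-1)^(d i) ([coef_rcons]).

    For words x and y put glue x y = sum_ij a_(i y) X_ij a_(x j), the
    propagator joining two cyclic vertices.  Three facts carry the proof.

    - glue is symmetric ([glueC]): X is antisymmetric, and exchanging the
      vertices produces the sign (-1)^(d i + d j) = -1 because X has odd degree.
    - glue x y lives on total degree -1 ([glue_deg]), where the sign of every
      rotation of x y is +1; so the coefficient of (S, S) at a word w of length n
      is 1/n times the sum of glue x y over all ways of rotating w and cutting
      it into nonempty x and y ([bracket_glue]).
    - Up to sign, omega(e_i, _) applied to m(p, m(v), q) is glue v (q i p)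
      ([omega_insert]).

    Take w = i u.  In each pair x, y the letter i lies either in y or in x.  The
    cuts of the first kind are exactly the terms of the A-infinity relation on u
    paired with e_i.  Exchanging x and y is a bijection onto the cuts of the
    second kind, so by symmetry of glue the master equation is twice that pairing
    ([sum_rotations_sym], [sum_glue_half]).  Both sides being multilinear, the
    relations on basis vectors imply them on all homogeneous vectors. *)

(** * Signs *)

Section Signs.
Variable K : fieldType.

Lemma sgnD m n : sgn K (m + n) = sgn K m * sgn K n.
Proof. by rewrite /sgn expfzDr // oppr_eq0 oner_eq0. Qed.

Lemma sgnN n : sgn K (- n) = sgn K n.
Proof. by rewrite /sgn -exprz_inv invrN1. Qed.

Lemma sgn_mul_self n : sgn K n * sgn K n = 1.
Proof. by rewrite -{2}sgnN -sgnD subrr. Qed.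

Lemma sgn1 : sgn K 1 = -1.
Proof. by []. Qed.

Lemma sgn_sqr n : sgn K (n * n) = sgn K n.
Proof.
rewrite {1}/sgn -exprz_exp -/(sgn K n).
have /eqP := sgn_mul_self n; rewrite -expr2 sqrf_eq1 => /orP[]/eqP e1.
  by rewrite e1 exp1rz.
by rewrite {1}e1.
Qed.

End Signs.

(** * Finitely supported sums *)

Section FiniteSums.
Variables (I : choiceType) (W : nmodType).

Lemma finite_supp_seq (f : I -> W) : finite_set [set i | f i != 0] ->
  exists2 s, uniq s & forall i, i \notin s -> f i = 0.
Proof.
move=> /finite_seqP[s fs]; exists (undup s); first exact: undup_uniq.
move=> i; rewrite mem_undup => /negP si; apply/eqP/negPn/negP => fi.
by apply: si; have: [set i | f i != 0] i by []; rewrite fs.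
Qed.

Lemma fsumTE (f : I -> W) s : uniq s -> (forall i, i \notin s -> f i = 0) ->
  \sum_(i \in [set: I]) f i = \sum_(i <- s) f i.
Proof.
move=> us fs; rewrite (fsbigE s) // => [|i _]; last exact: fs.
by apply: eq_bigl => i; rewrite mem_set.
Qed.

End FiniteSums.

Lemma sum_antidiagonal (W : nmodType) n (F : nat -> nat -> W) :
  \sum_(1 <= k < n.+1) \sum_(1 <= l < n.+1 | (k + l == n.+1)%N) F k l =
  \sum_(1 <= l < n.+1) F (n.+1 - l)%N l.
Proof.
under eq_bigr do rewrite big_mkcond /=.
rewrite exchange_big /= big_nat [RHS]big_nat; apply: eq_bigr => l ln.
have ln' : (n.+1 - l)%N \in index_iota 1 n.+1 by rewrite mem_index_iota; lia.
rewrite (bigD1_seq _ ln') ?iota_uniq //= subnK ?eqxx; last by lia.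
rewrite big1_seq ?addr0 // => k /andP[kl _]; case: eqP => // e.
by case/eqP: kl; lia.
Qed.

(** * Rotations of a word cut in two *)

Section Rotations.
Variables (T : Type) (W : zmodType) (F : seq T -> seq T -> W).
Hypothesis FC : forall x y, F x y = F y x.

(** A rotation of [w] cut after [l] letters is a pair x, y of complementary
    arcs.  For [1 <= r <= size w - l] the first letter of [w] falls into y;
    for the other [r] it falls into x, and exchanging the arcs, which [FC]
    allows, leads back to the first case with [l] replaced by [size w - l]. *)
Lemma sum_rotations_sym (w : seq T) (n := size w)
    (A := fun l r => F (take l (rot r w)) (drop l (rot r w))) :
  \sum_(1 <= l < n) \sum_(1 <= r < n.+1) A l r =
  (\sum_(1 <= l < n) \sum_(1 <= r < (n - l).+1) A l r) *+ 2.
Proof.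
have Asym l r : (l <= n)%N -> (r <= l)%N -> A l (r + (n - l))%N = A (n - l)%N r.
  move=> ln rl; rewrite /A addnC rotD; last by rewrite -/n; lia.
  set z := rot r w; rewrite FC.
  have sz : size (take (n - l) z) = (n - l)%N.
    by rewrite size_takel // size_rot -/n; lia.
  have sz' : size (drop (n - l) z) = l by rewrite size_drop size_rot -/n; lia.
  by rewrite /rot (take_size_cat _ sz') (drop_size_cat _ sz').
rewrite mulr2n [X in _ = _ + X]big_nat_rev -big_split /=.
apply: eq_big_nat => l /andP[l1 ln].
rewrite (big_cat_nat (n := (n - l).+1)) ?ltnS ?leq_subr //=.
congr (_ + _); rewrite -[X in \sum_(X <= _ < _) _]add1n big_addn.
have -> : (n.+1 - (n - l) = (n - (1 + n - l.+1)).+1)%N by lia.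
apply: eq_big_nat => r rl; rewrite Asym; [|lia..].
by rewrite add1n subSS.
Qed.

End Rotations.

(** * Multilinear maps and bases *)

Lemma linear_sum (K : numFieldType) (U W : lmodType K) (f : U -> W)
    (J : Type) (s : seq J) (c : J -> K) (g : J -> U) : linear f ->
  f (\sum_(i <- s) c i *: g i) = \sum_(i <- s) c i *: f (g i).
Proof.
move=> lf; have f0 : f 0 = 0.
  by have := lf (-1) 0 0; rewrite scaler0 add0r scaleN1r addNr.
elim: s => [|i s IH]; first by rewrite !big_nil.
by rewrite !big_cons lf IH.
Qed.

Lemma scalar_sum (K : numFieldType) (U : lmodType K) (f : U -> K)
    (J : Type) (s : seq J) (c : J -> K) (g : J -> U) : scalar f ->
  f (\sum_(i <- s) c i *: g i) = \sum_(i <- s) c i * f (g i).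
Proof. exact: (@linear_sum K U K^o). Qed.

Lemma take_cat_add (T : Type) (s t : seq T) k :
  take (size s + k) (s ++ t) = s ++ take k t.
Proof. by elim: s => //= x s ->. Qed.

Lemma drop_cat_add (T : Type) (s t : seq T) k :
  drop (size s + k) (s ++ t) = drop k t.
Proof. by elim: s. Qed.

Lemma drop_catl (T : Type) (s t : seq T) k : (k <= size s)%N ->
  drop k (s ++ t) = drop k s ++ t.
Proof.
move=> ks; rewrite drop_cat; case: ltnP => // sk.
have -> : k = size s by lia.
by rewrite subnn drop0 drop_size.
Qed.

Section Multilinear.
Variables (K : numFieldType) (H : lmodType K) (I : choiceType) (e : I -> H).

Section Induction.
Variables (L : Type) (lab : I -> L) (D : L -> {pred H}).
Hypothesis span : forall p x, x \in D p -> exists (s : seq I) (c : I -> K),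
  x = \sum_(i <- s) c i *: e i /\ forall i, i \in s -> lab i = p.

(** Reduction to basis vectors, one slot at a time from the left.  A slot
    carries a label, such as a degree, and [D p] is the span of the basis vectors
    labelled [p]: homogeneous lists and arbitrary lists, the latter with a
    trivial label, are both instances. *)
Lemma multilinear_ind (P : seq (L * H) -> Prop) :
  (forall s1 s2 p, P (s1 ++ (p, 0) :: s2)) ->
  (forall s1 s2 p a x y, P (s1 ++ (p, x) :: s2) -> P (s1 ++ (p, y) :: s2) ->
     P (s1 ++ (p, a *: x + y) :: s2)) ->
  (forall w, P [seq (lab i, e i) | i <- w]) ->
  forall s, all (fun q => q.2 \in D q.1) s -> P s.
Proof.
move=> P0 PD Pe s.
suff Pw w : all (fun q => q.2 \in D q.1) s ->
    P ([seq (lab i, e i) | i <- w] ++ s) by exact: (Pw [::]).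
elim: s w => [|[p x] s IH] w /=; first by rewrite cats0.
move=> /andP[/span[t [c [-> tp]]] Ds].
elim: t tp => [|i t IHt] tp; first by rewrite big_nil.
rewrite big_cons; apply: PD; last first.
  by apply: IHt => j jt; apply: tp; rewrite inE jt orbT.
rewrite -(tp i) ?mem_head //.
by have := IH (rcons w i) Ds; rewrite map_rcons cat_rcons.
Qed.

Lemma multilinear_eq (W : lmodType K) (F G : seq (L * H) -> W) n :
  (forall s1 s2 p, linear (fun x => F (s1 ++ (p, x) :: s2))) ->
  (forall s1 s2 p, linear (fun x => G (s1 ++ (p, x) :: s2))) ->
  (forall w, size w = n -> F [seq (lab i, e i) | i <- w] =
                           G [seq (lab i, e i) | i <- w]) ->
  forall s, all (fun q => q.2 \in D q.1) s -> size s = n -> F s = G s.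
Proof.
move=> lF lG FG s Ds.
move: s Ds; apply: multilinear_ind => [s1 s2 p _|s1 s2 p a x y|w].
- have F0 := lF s1 s2 p (-1) 0 0; have G0 := lG s1 s2 p (-1) 0 0.
  by move: F0 G0; rewrite !scaler0 !addr0 !scaleN1r !addNr => -> ->.
- rewrite !size_cat /= => Fx Fy sn.
  by rewrite (lF s1 s2 p a x y) (lG s1 s2 p a x y) Fx // Fy.
- by rewrite size_map; apply: FG.
Qed.

End Induction.

(** The slot being varied lies before, inside or after the arguments of the
    inner operation. *)
Lemma multilinear_insert (m : seq H -> H) (j l : nat) : multilinear m ->
  multilinear (fun o => m (take j o ++ m (take l (drop j o)) :: drop (j + l) o)).
Proof.
move=> lm s1 s2 a x y; rewrite [(j + l)%N]addnC -!drop_drop.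
have [sj|js] := ltnP (size s1) j.
  have -> : j = (size s1 + (j - size s1).-1.+1)%N by lia.
  by rewrite !take_cat_add !drop_cat_add /= -!catA /= lm.
have sj : size (take j s1) = j by rewrite size_takel.
rewrite -(cat_take_drop j s1) -!catA.
rewrite !(take_size_cat _ sj) !(drop_size_cat _ sj).
set p := take j s1; set q := drop j s1.
have [ql|lq] := ltnP (size q) l.
  have -> : l = (size q + (l - size q).-1.+1)%N by lia.
  by rewrite !take_cat_add !drop_cat_add /= lm lm.
by rewrite !takel_cat // !drop_catl // -!cat_cons !catA lm.
Qed.

Fixpoint multilinear_extension (phi : I -> H -> K) (g : seq I -> H)
    (s : seq H) : H :=
  if s is x :: s' then
    \sum_(i \in [set: I])
      phi i x *: multilinear_extension phi (fun w => g (i :: w)) s'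
  else g [::].

Variable phi : I -> H -> K.
Hypothesis phi_lin : forall i, scalar (phi i).
Hypothesis phi_e : forall i j, phi i (e j) = (i == j)%:R.
Hypothesis phi_fin : forall x, finite_set [set i | phi i x != 0].

Lemma multilinear_extensionP g : multilinear (multilinear_extension phi g).
Proof.
move=> s1 s2; elim: s1 g => [|z s1 IH] g a x y /=.
  have [sx ux Ex] := finite_supp_seq (phi_fin x).
  have [sy uy Ey] := finite_supp_seq (phi_fin y).
  set s := undup (sx ++ sy).
  have us : uniq s by exact: undup_uniq.
  have [sX sY] : (forall i, i \notin s -> phi i x = 0) /\
                 (forall i, i \notin s -> phi i y = 0).
    by split=> i; rewrite mem_undup mem_cat negb_or => /andP[? ?];
      [apply: Ex|apply: Ey].
  rewrite !(fsumTE us); try by move=> i ins; rewrite ?phi_lin ?sX ?sY // ?mulr0 ?addr0 ?scale0r.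
  rewrite scaler_sumr -big_split /=; apply: eq_bigr => i _.
  by rewrite phi_lin scalerDl scalerA.
have [sz uz Ez] := finite_supp_seq (phi_fin z).
rewrite !(fsumTE uz); try by move=> i ins; rewrite Ez // scale0r.
rewrite scaler_sumr -big_split /=; apply: eq_bigr => i _.
by rewrite IH scalerDr !scalerA mulrC.
Qed.

Lemma multilinear_extension_basis g w :
  multilinear_extension phi g (map e w) = g w.
Proof.
elim: w g => [|j w IH] g //=.
rewrite (fsumTE (s := [:: j])) //.
  by rewrite big_seq1 phi_e eqxx scale1r IH.
by move=> i; rewrite inE phi_e => /negPf ->; rewrite scale0r.
Qed.

End Multilinear.

(** * The symplectically dual basis *)

Section DualBasis.
Variables (K : numFieldType) (H : lmodType K) (gr : int -> {pred H}).
Variables (omega : H -> H -> K) (I : choiceType) (e : I -> H) (d : I -> int).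
Variable (omega_inv : I -> I -> K).
Hypothesis gr_sub : forall n, submod_closed (gr n).
Hypothesis Homega : is_odd_symplectic gr omega.
Hypothesis He : is_homogeneous_basis gr e d.
Hypothesis Hinv : is_inverse_matrix e omega omega_inv.

Local Notation X := omega_inv.

Lemma gr_lincomb n (J : eqType) (s : seq J) (c : J -> K) (g : J -> H) :
  (forall i, i \in s -> c i != 0 -> g i \in gr n) ->
  \sum_(i <- s) c i *: g i \in gr n.
Proof.
have [gr0 grD] := gr_sub n.
elim: s => [|i s IH] sg; first by rewrite big_nil.
have sn : \sum_(j <- s) c j *: g j \in gr n.
  by apply: IH => j js; apply: sg; rewrite inE js orbT.
rewrite big_cons; have [->|ci] := eqVneq (c i) 0.
  by rewrite scale0r add0r.
by apply: grD => //; apply: sg; rewrite ?mem_head.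
Qed.

Lemma omega_linl y : scalar (omega ^~ y).
Proof. by have [[_ ?]] := Homega. Qed.

Lemma omega_linr x : scalar (omega x).
Proof. by have [[? _]] := Homega. Qed.

Lemma omegaC x y : omega y x = - omega x y.
Proof. by have [_ /(_ x y)] := Homega. Qed.

Lemma omega_deg p q x y : x \in gr p -> y \in gr q -> p + q != 1 ->
  omega x y = 0.
Proof.
have [_ _ om _ px qy pq] := Homega; apply/eqP/negPn/negP => /(om _ _ _ _ px qy).
by apply/eqP.
Qed.

Lemma basis_gr i : e i \in gr (d i).
Proof. by have [] := He. Qed.

Lemma basis_span x : exists (s : seq I) (c : I -> K),
  x = \sum_(i <- s) c i *: e i.
Proof. by have [_ + _] := He; apply. Qed.

(** Nondegeneracy tested on a basis; this is how identities between vectors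
    are reduced to identities between coefficients. *)
Lemma omega_basis_inj x y : (forall i, omega (e i) x = omega (e i) y) -> x = y.
Proof.
move=> xy; apply/eqP; rewrite -subr_eq0; apply/eqP.
have [_ _ _ nd] := Homega; apply: nd => z.
have [s [c ->]] := basis_span z.
rewrite (scalar_sum _ _ _ (omega_linr _)) big1 // => i _.
by rewrite omegaC -[x - y]addrC -scaleN1r omega_linr xy mulN1r addNr oppr0 mulr0.
Qed.

(** Discarding the basis vectors of the wrong degree does not change the
    pairings with the basis, because [omega] only pairs degrees of sum 1; so by
    nondegeneracy it does not change the vector. *)
Lemma homogeneous_span p x : x \in gr p -> exists (s : seq I) (c : I -> K),
  x = \sum_(i <- s) c i *: e i /\ forall i, i \in s -> d i = p.
Proof.
move=> px; have [s [c xE]] := basis_span x.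
exists [seq i <- s | d i == p], c; split; last first.
  by move=> i; rewrite mem_filter => /andP[/eqP].
apply: omega_basis_inj => j.
rewrite (scalar_sum _ _ _ (omega_linr _)) big_filter.
have [jp|jp] := eqVneq (d j + p) 1; last first.
  rewrite (omega_deg (basis_gr j) px jp) big1 // => i /eqP ip.
  by rewrite (omega_deg (basis_gr j) (basis_gr i)) ?mulr0 // ip.
rewrite xE (scalar_sum _ _ _ (omega_linr _)) [LHS](bigID (fun i => d i == p)) /=.
rewrite [X in _ + X]big1 ?addr0 // => i ip.
rewrite (omega_deg (basis_gr j) (basis_gr i)) ?mulr0 // -jp.
by rewrite (inj_eq (addrI _)).
Qed.

Definition dual_vec (k : I) : H := \sum_(j \in [set: I]) X j k *: e j.

Lemma dual_vec_seq k : exists2 s, uniq s & (forall j, j \notin s -> X j k = 0) /\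
  dual_vec k = \sum_(j <- s) X j k *: e j.
Proof.
have [s us sX] := finite_supp_seq (Hinv.1 k); exists s => //; split=> //.
by rewrite /dual_vec (fsumTE us) // => j /sX ->; rewrite scale0r.
Qed.

Lemma scalar_dual_vec (g : H -> K) k : scalar g ->
  g (dual_vec k) = \sum_(j \in [set: I]) X j k * g (e j).
Proof.
move=> lg; have [s us [sX ->]] := dual_vec_seq k.
by rewrite (scalar_sum _ _ _ lg) (fsumTE us) // => j /sX ->; rewrite mul0r.
Qed.

Lemma omega_dual_vec i k : omega (e i) (dual_vec k) = (i == k)%:R.
Proof.
rewrite (scalar_dual_vec k (omega_linr _)) -Hinv.2.
by apply: eq_fsbigr => j _; rewrite mulrC.
Qed.

Lemma omega_invE j k : X j k = omega (dual_vec k) (dual_vec j).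
Proof.
rewrite (scalar_dual_vec k (omega_linl _)) (fsumTE (s := [:: j])) //.
  by rewrite big_seq1 omega_dual_vec eqxx mulr1.
by move=> i; rewrite inE omega_dual_vec => /negPf ->; rewrite mulr0.
Qed.

(** For infinite [I] an inverse of an antisymmetric matrix need not obviously
    be antisymmetric; it is here because its entries are the pairings of the dual
    vectors. *)
Lemma omega_inv_antisym j k : X k j = - X j k.
Proof. by rewrite !omega_invE omegaC. Qed.

(** The part of the dual vector in degree [1 - d k] already has the defining
    pairings, hence is the whole vector. *)
Lemma omega_inv_deg j k : X j k != 0 -> d j + d k = 1.
Proof.
have [s us [sX fE]] := dual_vec_seq k.
have fE' : dual_vec k = \sum_(i <- s | d i + d k == 1) X i k *: e i.
  apply: omega_basis_inj => i; rewrite -big_filter.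
  rewrite [RHS](scalar_sum _ _ _ (omega_linr _)) big_filter.
  have [ik|ik] := eqVneq (d i) (d k); last first.
    rewrite omega_dual_vec; case: eqP => [iek|_]; first by rewrite iek eqxx in ik.
    rewrite big1 // => l /eqP lk.
    rewrite (omega_deg (basis_gr i) (basis_gr l)) ?mulr0 // -lk addrC.
    by rewrite (inj_eq (addrI _)).
  rewrite fE (scalar_sum _ _ _ (omega_linr _)).
  rewrite [LHS](bigID (fun l => d l + d k == 1)) /=.
  rewrite [X in _ + X]big1 ?addr0 // => l lk.
  by rewrite (omega_deg (basis_gr i) (basis_gr l)) ?mulr0 // ik addrC.
apply: contra_neq_eq => jk; rewrite omega_invE fE' -big_filter.
rewrite (scalar_sum _ _ _ (omega_linl _)) big_filter big1 // => i ik.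
rewrite omega_dual_vec; case: eqP => [ij|_]; last by rewrite mulr0.
by rewrite ij (negPf jk) in ik.
Qed.

Lemma dual_vec_gr k : dual_vec k \in gr (1 - d k).
Proof.
have [s _ [_ ->]] := dual_vec_seq k; apply: gr_lincomb => j _ /omega_inv_deg <-.
by rewrite addrK basis_gr.
Qed.

Definition coord (k : I) (x : H) : K := omega x (dual_vec k).

Lemma coord_fin x : finite_set [set i | coord i x != 0].
Proof.
have [s [c ->]] := basis_span x; apply: (@sub_finite_set _ _ [set` s]) => //.
move=> i /=; apply: contraNT => si.
rewrite /coord (scalar_sum _ _ _ (omega_linl _)) big1_seq // => j /andP[_ js].
rewrite omega_dual_vec; case: eqP => [ji|]; last by rewrite mulr0.
by rewrite -ji js in si.
Qed.

(** * The bracket as a gluing of two cyclic words *)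

Section Action.
Variable A : series K I.
Hypothesis Afin : locally_finite A.
Hypothesis Adeg : has_degree d 0 A.
Hypothesis Acyc : Cphi_c d A.
Hypothesis A_no_linear : forall i, A [:: i] = 0.

Local Notation a := (coef A).
Local Notation deg w := (\sum_(i <- w) d i).

Lemma deg_cons i w : deg (i :: w) = d i + deg w.
Proof. by rewrite big_cons. Qed.

Lemma deg_rcons w i : deg (rcons w i) = deg w + d i.
Proof. by rewrite big_rcons. Qed.

Lemma coef_small w : (size w < 2)%N -> a w = 0.
Proof.
by case: w => [|i [|//]] _; rewrite /coef ?A_no_linear ?mulr0 // mul0r.
Qed.

Lemma coef_deg w : a w != 0 -> deg w = 0.
Proof.
rewrite /coef mulf_eq0 negb_or => /andP[_ /Adeg].
by rewrite sumrN => /eqP; rewrite oppr_eq0 => /eqP.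
Qed.

Lemma coef_fin w : finite_set [set i | a (i :: w) != 0].
Proof.
apply: sub_finite_set (Afin w) => i /=.
by rewrite /coef mulf_eq0 negb_or => /andP[].
Qed.

(** On words of total degree zero the Koszul exponent [deg w * d i] is
    [- d i * d i], which has the parity of [d i]. *)
Lemma coef_rcons i w : a (i :: w) = sgn K (d i) * a (rcons w i).
Proof.
have aE := Acyc.2 i w; have [w0|w0] := eqVneq (a (rcons w i)) 0.
  by rewrite aE w0 !mulr0.
rewrite aE; have -> : deg w = - d i by move: (coef_deg w0); rewrite deg_rcons; lia.
by rewrite mulNr sgnN sgn_sqr.
Qed.

Lemma coef_catC x y : a (x ++ y) = sgn K (deg x) * a (y ++ x).
Proof.
elim: x y => [|i x IH] y; first by rewrite big_nil cats0 /sgn expr0z mul1r.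
by rewrite cat_cons coef_rcons -cats1 -catA IH big_cons sgnD -catA mulrA.
Qed.

(** Two cyclic vertices joined by the propagator; the letters of [x] and [y]
    are the free legs. *)
Definition glue (x y : seq I) : K :=
  \sum_(i \in [set: I]) \sum_(j \in [set: I])
    a (i :: y) * X i j * a (rcons x j).

Lemma contraction_glue l w :
  contraction X l a a w = glue (take l.-1 w) (drop l.-1 w).
Proof. by []. Qed.

Lemma glue_seq x y s t : uniq s -> uniq t ->
  (forall i, i \notin s -> a (i :: y) = 0) ->
  (forall j, j \notin t -> a (j :: x) = 0) ->
  glue x y = \sum_(i <- s) \sum_(j <- t) a (i :: y) * X i j * a (rcons x j).
Proof.
move=> us ut sy tx; have tx' j : j \notin t -> a (rcons x j) = 0.
  by move/tx/eqP; rewrite coef_rcons mulf_eq0 => /orP[/eqP s0|/eqP //];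
    have /eqP := sgn_mul_self K (d j); rewrite s0 mul0r eq_sym oner_eq0.
rewrite /glue (fsumTE us); last first.
  by move=> i /sy ->; apply: fsbig1 => j _; rewrite !mul0r.
by apply: eq_bigr => i _; rewrite (fsumTE ut) // => j /tx' ->; rewrite mulr0.
Qed.

(** Three signs cancel: [X] is antisymmetric, and cyclicity at the two
    vertices gives the sign of [d i + d j], which is odd. *)
Lemma glueC x y : glue x y = glue y x.
Proof.
have [s us sy] := finite_supp_seq (coef_fin y).
have [t ut tx] := finite_supp_seq (coef_fin x).
rewrite (glue_seq us ut sy tx) (glue_seq ut us tx sy) exchange_big /=.
apply: eq_bigr => j _; apply: eq_bigr => i _.
rewrite (omega_inv_antisym i j).
have [->|ij] := eqVneq (X i j) 0; first by rewrite oppr0 !mulr0 !mul0r.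
rewrite (coef_rcons i y) (coef_rcons j x).
have -> : sgn K (d j) = - sgn K (d i).
  rewrite -[LHS]mul1r -(sgn_mul_self K (d i)) -mulrA -sgnD (omega_inv_deg ij).
  by rewrite sgn1 mulrN1.
ring.
Qed.

Lemma glue_deg x y : glue x y != 0 -> deg x + deg y = -1.
Proof.
apply: contra_neq_eq => xy; apply: fsbig1 => i _; apply: fsbig1 => j _.
have [->|/coef_deg iy] := eqVneq (a (i :: y)) 0; first by rewrite !mul0r.
have [->|/omega_inv_deg ij] := eqVneq (X i j) 0; first by rewrite mulr0 mul0r.
have [->|/coef_deg xj] := eqVneq (a (rcons x j)) 0; first by rewrite mulr0.
by case/eqP: xy; rewrite deg_cons in iy; rewrite deg_rcons in xj; lia.
Qed.

Lemma glue_nill y : glue [::] y = 0.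
Proof.
by apply: fsbig1 => i _; apply: fsbig1 => j _; rewrite (@coef_small [:: j]) ?mulr0.
Qed.

Lemma glue_nilr x : glue x [::] = 0.
Proof. by rewrite glueC glue_nill. Qed.

(** No rotation signs are left: in total degree -1 the two parts of a
    rotated word have degrees p and -1 - p, and p (-1 - p) is even. *)
Lemma bracket_glue w : bracket d X A A w = (size w)%:R^-1 *
  \sum_(1 <= l < size w) \sum_(1 <= r < (size w).+1)
    glue (take l (rot r w)) (drop l (rot r w)).
Proof.
set n := size w.
have cyc l : cyclic_sum d (contraction X l.+1 a a) w =
    \sum_(1 <= r < n.+1) glue (take l (rot r w)) (drop l (rot r w)).
  rewrite big_add1 /= big_nat_rev /= big_mkord /cyclic_sum.
  apply: eq_bigr => r _; rewrite contraction_glue /=.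
  have -> : rotr r w = rot (0 + n - r.+1).+1 w.
    by rewrite /rotr; congr (rot _ w); rewrite -/n; have := ltn_ord r; rewrite -/n; lia.
  set z := rot _ w; have [->|/glue_deg zl] := eqVneq (glue (take l z) (drop l z)) 0.
    by rewrite mulr0.
  rewrite /rot_sign -[RHS]mul1r; congr (_ * _).
  have rz : deg (take r z) + deg (drop r z) = -1.
    by rewrite -big_cat cat_take_drop -zl -big_cat cat_take_drop.
  have -> : deg (drop r z) = - 1 - deg (take r z) by lia.
  by rewrite mulrBr mulrN1 sgnD !sgnN sgn_sqr sgn_mul_self.
rewrite /bracket -/n [LHS](_ : _ = \sum_(1 <= k < n.+2)
    \sum_(1 <= l < n.+2 | (k + l == n.+2)%N) n%:R^-1 *
      cyclic_sum d (contraction X l a a) w); last first.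
  apply: eq_big_nat => k /andP[k1 _].
  rewrite big_nat_cond [RHS]big_nat_cond; apply: eq_big => l.
    by apply/idP/idP => /andP[? /eqP ?]; apply/andP; split => //; apply/eqP; lia.
  by move=> /andP[_ /eqP ->].
rewrite sum_antidiagonal -mulr_sumr; congr (_ * _).
rewrite big_add1 /= (eq_bigr _ (fun l _ => cyc l)).
have [n0|n0] := posnP n.
  by rewrite n0 big_nat1 [RHS]big_geq // big_geq.
(* The cuts with an empty part involve a vertex with a single leg. *)
rewrite big_ltn // [X in X + _]big1 ?add0r => [|r _]; last by rewrite take0 glue_nill.
rewrite big_nat_recr //= [X in _ + X]big1 ?addr0 // => r _.
by rewrite drop_oversize ?glue_nilr // size_rot.
Qed.

(** * The structure maps *)

(** The only vector whose pairing with [e i] is the sign of [d i] times the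
    coefficient of [i :: w]. *)
Definition structure_vec (w : seq I) : H :=
  \sum_(c \in [set: I]) (sgn K (d c) * a (c :: w)) *: dual_vec c.

Definition structure_map : seq H -> H :=
  multilinear_extension coord structure_vec.

Local Notation m := structure_map.

Lemma structure_mapP : multilinear m.
Proof.
apply: multilinear_extensionP => [i|x]; first exact: omega_linl.
exact: coord_fin.
Qed.

Lemma structure_map_basis w : m (map e w) = structure_vec w.
Proof.
apply: multilinear_extension_basis => i j.
by rewrite /coord omega_dual_vec eq_sym.
Qed.

Lemma structure_vec_seq w : exists2 s, uniq s &
  (forall c, c \notin s -> a (c :: w) = 0) /\
  structure_vec w = \sum_(c <- s) (sgn K (d c) * a (c :: w)) *: dual_vec c.
Proof.
have [s us sw] := finite_supp_seq (coef_fin w); exists s => //; split=> //.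
by rewrite /structure_vec (fsumTE us) // => c /sw ->; rewrite mulr0 scale0r.
Qed.

Lemma omega_structure_vec i w :
  omega (e i) (structure_vec w) = sgn K (d i) * a (i :: w).
Proof.
have [s us [sw ->]] := structure_vec_seq w.
rewrite (scalar_sum _ _ _ (omega_linr _)).
have [si|si] := boolP (i \in s); last first.
  rewrite sw // mulr0 big1_seq // => c /andP[_ cs].
  rewrite omega_dual_vec; case: eqP => [ic|_]; last by rewrite mulr0.
  by rewrite ic cs in si.
rewrite (bigD1_seq i) //= omega_dual_vec eqxx mulr1 big1 ?addr0 // => c ci.
by rewrite omega_dual_vec eq_sym (negPf ci) mulr0.
Qed.

Lemma structure_vec_gr w : structure_vec w \in gr (deg w + 1).
Proof.
have [s _ [_ ->]] := structure_vec_seq w; apply: gr_lincomb => c _.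
rewrite mulf_eq0 negb_or => /andP[_ /coef_deg]; rewrite deg_cons => cw.
by have -> : deg w + 1 = 1 - d c by [lia]; exact: dual_vec_gr.
Qed.

Lemma structure_map_deg : degree_one gr m.
Proof.
move=> s _; apply: (multilinear_ind (lab := d) (D := gr) homogeneous_span
   (P := fun s => m (unzip2 s) \in gr (degs s + 1))) => [s1 s2 p|s1 s2 p c x y|w].
- have := structure_mapP (unzip2 s1) (unzip2 s2) (-1) 0 0.
  rewrite scaler0 !addr0 scaleN1r addNr /unzip2 map_cat /= => ->.
  by have [] := gr_sub (degs (s1 ++ (p, 0) :: s2) + 1).
- rewrite /degs !big_cat !big_cons /= /unzip2 !map_cat /= structure_mapP.
  by have [_] := gr_sub (\sum_(q <- s1) q.1 + (p + \sum_(q <- s2) q.1) + 1); apply.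
- rewrite /unzip2 -map_comp /= structure_map_basis /degs big_map.
  exact: structure_vec_gr.
Qed.

Lemma structure_map_cyclic d1 d2 o1 o2 s :
  o1 \in gr d1 -> o2 \in gr d2 -> homogeneous gr s ->
  omega o1 (m (o2 :: unzip2 s)) = sgn K d2 * omega o2 (m (rcons (unzip2 s) o1)).
Proof.
move=> g1 g2 gs.
(* Both sides as functions of the whole list [o1 :: o2 :: s], so that all the
   slots can be reduced to basis vectors at once. *)
pose F (t : seq (int * H)) : K^o :=
  let o := unzip2 t in omega (head 0 o) (m (behead o)).
pose G (t : seq (int * H)) : K^o := let o := unzip2 t in
  sgn K (nth 0 (unzip1 t) 1) * omega (nth 0 o 1) (m (rcons (drop 2 o) (head 0 o))).
suff: F [:: (d1, o1), (d2, o2) & s] = G [:: (d1, o1), (d2, o2) & s].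
  by rewrite /F /G /= drop0.
apply: (multilinear_eq (lab := d) (D := gr) homogeneous_span
  (n := (size s).+2)) => //; last by rewrite /= g1 g2.
- move=> [|q s1] s2 p c x y; rewrite /F /unzip2 ?map_cat /=.
    by rewrite omega_linl.
  by rewrite structure_mapP omega_linr.
- move=> [|q [|q' s1]] s2 p c x y; rewrite /G /unzip2 ?map_cat /=.
  + by rewrite -!cats1 structure_mapP omega_linr mulrDr mulrCA.
  + by rewrite omega_linl mulrDr mulrCA.
  + rewrite !drop0 !rcons_cat /= structure_mapP omega_linr.
    by rewrite mulrDr mulrCA.
- move=> [|i [|j w]] // _; rewrite /F /G /= drop0.
  rewrite /unzip2 -!map_comp /= -map_rcons.
  rewrite -(map_cons e j w) !structure_map_basis !omega_structure_vec.
  by rewrite coef_rcons !mulrA !sgn_mul_self !mul1r.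
Qed.

(** The inner operation expands over the dual vectors, whose coordinates are
    the entries of [X]: this produces the propagator.  Rotating the outer vertex
    until the joined leg comes first gives the word [q ++ i :: p]. *)
Lemma omega_insert i p v q :
  sgn K (deg p) * omega (e i) (m (map e p ++ m (map e v) :: map e q)) =
  glue v (q ++ i :: p).
Proof.
have [t ut [tv vE]] := structure_vec_seq v.
have [s us sy] := finite_supp_seq (coef_fin (q ++ i :: p)).
rewrite (glue_seq us ut sy tv) exchange_big /= structure_map_basis vE.
have lin : scalar (fun x => omega (e i) (m (map e p ++ x :: map e q))).
  by move=> c x y; rewrite structure_mapP omega_linr.
have arg b : omega (e i) (m (map e p ++ e b :: map e q)) =
    sgn K (deg p) * a (b :: q ++ i :: p).
  rewrite -map_cons -map_cat structure_map_basis omega_structure_vec.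
  rewrite -cat_cons coef_catC deg_cons sgnD !mulrA sgn_mul_self mul1r.
  by rewrite cat_cons.
rewrite (scalar_sum _ _ _ lin) mulr_sumr; apply: eq_bigr => c _.
rewrite (scalar_dual_vec c lin) (fsumTE us); last first.
  by move=> b /sy ay; rewrite arg ay !mulr0.
rewrite !mulr_sumr; apply: eq_bigr => b _.
rewrite arg (coef_rcons c v).
rewrite -[RHS]mul1r -(sgn_mul_self K (d c)) -[RHS]mul1r.
by rewrite -(sgn_mul_self K (deg p)); ring.
Qed.

Hypothesis master : forall w, bracket d X A A w = 0.

(** Characteristic zero is used twice: for the factor 2 and for the
    normalisation [(size w)^-1] of the bracket. *)
Lemma sum_glue_half w :
  \sum_(1 <= l < size w) \sum_(1 <= r < (size w - l).+1)
    glue (take l (rot r w)) (drop l (rot r w)) = 0.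
Proof.
have [->|w0] := posnP (size w); first by rewrite big_geq.
have := master w; rewrite bracket_glue (sum_rotations_sym glueC) => /eqP.
rewrite mulf_eq0 invr_eq0 pnatr_eq0 eqn0Ngt w0 /= mulrn_eq0 /=.
by move/eqP.
Qed.

Lemma structure_map_Ainf : Ainf_relations gr m.
Proof.
move=> s _ gs.
pose F (N : nat) (t : seq (int * H)) : H :=
  let o := unzip2 t in
  \sum_(1 <= l < N.+1) \sum_(0 <= j < N.+1 - l)
    sgn K (degs (take j t)) *:
      m (take j o ++ m (take l (drop j o)) :: drop (j + l) o).
cbv zeta; rewrite sum_antidiagonal -/(F (size s) s).
apply: (multilinear_eq (lab := d) (D := gr) homogeneous_span (F := F (size s))
  (G := fun=> 0) (n := size s)) => // [s1 s2 p|s1 s2 p c x y|w <-].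
- move=> c x y; rewrite /F scaler_sumr -big_split; apply: eq_bigr => l _.
  rewrite scaler_sumr -big_split; apply: eq_bigr => j _ /=.
  (* The sign depends on the labels only, not on the vector in the slot. *)
  have degsE z : degs (take j (s1 ++ (p, z) :: s2)) = degs (take j (s1 ++ (p, 0) :: s2)).
    rewrite /degs -[LHS](big_map fst xpredT id) -[RHS](big_map fst xpredT id).
    by rewrite !map_take !map_cat.
  rewrite (degsE (c *: x + y)) (degsE x) (degsE y).
  rewrite /unzip2 !map_cat /= (multilinear_insert j l structure_mapP).
  by rewrite scalerDr !scalerA mulrC.
- by rewrite scaler0 addr0.
- apply: omega_basis_inj => i; rewrite /F.
  have oS (J : Type) (r : seq J) (g : J -> H) :
      omega (e i) (\sum_(k <- r) g k) = \sum_(k <- r) omega (e i) (g k).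
    have := scalar_sum r (fun=> 1) g (omega_linr (e i)).
    by under eq_bigr do rewrite scale1r; under [RHS]eq_bigr do rewrite mul1r.
  have -> : omega (e i) 0 = 0.
    by have := oS void [::] (fun=> 0); rewrite !big_nil.
  rewrite oS -[RHS](sum_glue_half (i :: w)) /=.
  apply: eq_big_nat => l /andP[_ ln]; rewrite oS big_add1 /=.
  apply: eq_big_nat => j /andP[_ jl].
  have scal z k : omega (e i) (k *: z) = k * omega (e i) z.
    by have := scalar_sum [:: z] (fun=> k) id (omega_linr (e i)); rewrite !big_seq1.
  rewrite scal /rot /=.
  have jw : (j <= size w)%N by lia.
  have lw : (l <= size (drop j w))%N by rewrite size_drop; lia.
  rewrite takel_cat // drop_catl // drop_drop [(l + j)%N]addnC -omega_insert.
  have -> : unzip2 [seq (d k, e k) | k <- w] = map e w by rewrite /unzip2 -map_comp.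
  by rewrite -!map_take -!map_drop -map_take /degs big_map.
Qed.

End Action.
End DualBasis.

Lemma multilinear_unique_on_basis (K : numFieldType) (H : lmodType K) (I : choiceType)
    (e : I -> H) (m m' : seq H -> H) :
  (forall x, exists (s : seq I) (c : I -> K), x = \sum_(i <- s) c i *: e i) ->
  multilinear m -> multilinear m' ->
  (forall w, w != [::] -> m (map e w) = m' (map e w)) ->
  forall s, s != [::] -> m s = m' s.
Proof.
move=> span lm lm' mm' s s0.
have sE : s = unzip2 [seq (tt, x) | x <- s] by rewrite /unzip2 -map_comp map_id.
rewrite sE.
apply: (multilinear_eq (e := e) (lab := fun=> tt) (D := fun=> predT) _
  (F := fun t => m (unzip2 t)) (G := fun t => m' (unzip2 t)) (n := size s)).
- by move=> [] x _; have [t [c xE]] := span x; exists t, c.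
- by move=> s1 s2 p a x y; rewrite /unzip2 !map_cat /= lm.
- by move=> s1 s2 p a x y; rewrite /unzip2 !map_cat /= lm'.
- move=> w ws; rewrite /unzip2 -map_comp; apply: mm'.
  by move: ws; case: (w) s0 => //; case: (s).
- by apply/allP.
- by rewrite size_map.
Qed.

Theorem theorem6p1 (R : realType) (H : lmodType R[i]) (gr : int -> {pred H})
    (omega : H -> H -> R[i]) (I : choiceType) (e : I -> H) (d : I -> int)
    (omega_inv : I -> I -> R[i]) (V : seq I -> R[i])
    (Hgr : is_grading gr)
    (Homega : is_odd_symplectic gr omega)
    (He : is_homogeneous_basis gr e d)
    (Hinv : is_inverse_matrix e omega omega_inv)
    (Vfin : locally_finite (action V))
    (Sdeg : has_degree d 0 (action V))
    (Scyc : Cphi_c d (action V))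
    (Smaster : forall w, bracket d omega_inv (action V) (action V) w = 0) :
  exists m : seq H -> H,
    [/\ determined_by e d omega V m,
        forall m' : seq H -> H, determined_by e d omega V m' ->
          forall s : seq H, s != [::] -> m' s = m s
      & cyclic_Ainf_algebra gr omega m].
Proof.
have [gr_sub _ _] := Hgr.
have no_linear i : action V [:: i] = 0 by [].
have VE i w : w != [::] -> coef (action V) (i :: w) = V (i :: w).
  case: w => // j w _; rewrite /coef /action /= mulrA divff ?mul1r //.
  by rewrite pnatr_eq0.
pose m := structure_map omega e d omega_inv (action V).
have mlin : multilinear m by exact: (structure_mapP Homega He Hinv).
have mV i w : sgn R[i] (d i) * omega (e i) (m (map e w)) = coef (action V) (i :: w).
  rewrite /m (structure_map_basis d Homega Hinv).
  rewrite (omega_structure_vec d Homega Hinv Vfin).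
  by rewrite mulrA sgn_mul_self mul1r.
exists m; split.
- by split=> // i w /VE <-.
- move=> m' [m'lin m'V]; apply: (multilinear_unique_on_basis (e := e)) => //.
    by have [] := He.
  move=> w w0; apply: (omega_basis_inj Homega He) => i.
  have := m'V i w w0; rewrite -(VE i w w0) -mV.
  by move=> /(congr1 ( *%R (sgn _ (d i)))); rewrite !mulrA sgn_mul_self !mul1r.
- split; first split=> //.
  + exact: structure_map_deg.
  + exact: structure_map_Ainf.
  + exact: structure_map_cyclic.
Qed.
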